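(* Let $(X,d)$ be a compact metric space, let $m\ge 1$, let $f_0,\dots,f_{m-1}:X\to X$ be continuous maps and let $G=\{f_0,\dots,f_{m-1}\}$ be the free semigroup action they generate. Then the topological entropy $h(G)$ of the free semigroup action coincides with its pseudo-entropy $h^*(G)$, i.e. $h(G)=h^*(G)$.
   Context: $F_m^+$ is the set of finite words in the symbols $0,\dots,m-1$; $|w|$ is the length of $w$. For $w=i_0i_1\cdots i_{k-1}$ put $f_w=f_{i_0}\circ f_{i_1}\circ\cdots\circ f_{i_{k-1}}$ and $\overline w=i_{k-1}\cdots i_1i_0$; write $w'\le w$ if $w=w''w'$ for some word $w''$ (that is, $w'$ is a suffix of $w$; the empty suffix is allowed, with $f_\emptyset=\mathrm{id}$). Topological entropy (Bufetov). For $w\in F_m^+$ let $d_w(x_1,x_2)=\max_{w'\le\overline w}d(f_{w'}(x_1),f_{w'}(x_2))$. A subset $K\subset X$ is $(w,\varepsilon,G)$-separated if $d_w(x_1,x_2)\ge\varepsilon$ for all distinct $x_1,x_2\in K$; $N(w,\varepsilon,G)$ is the maximum cardinality of such a set. Put $N(n,\varepsilon,G)=\frac1{m^n}\sum_{|w|=n}N(w,\varepsilon,G)$ and $$h(G)=\lim_{\varepsilon\to0}\limsup_{n\to\infty}\frac1n\log N(n,\varepsilon,G).$$ Pseudo-entropy. For $w=i_0\cdots i_{n-1}\in F_m^+$ and $\delta>0$, a $(w,\delta)$-chain of $G$ is a sequence $(x_0,\dots,x_n)$ in $X$ with $d(f_{i_j}(x_j),x_{j+1})\le\delta$ for $j=0,\dots,n-1$.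 Let $E(w,\delta)$ be the set of all $(w,\delta)$-chains. A subset $K\subset E(w,\delta)$ is $(w,\varepsilon,\delta,G)$-pseudo-separated if for any two distinct $(x_i)_{i=0}^n,(y_i)_{i=0}^n\in K$ there is $0\le i<n$ with $d(x_i,y_i)>\varepsilon$; $N^*(w,\varepsilon,\delta,G)$ is the maximum cardinality of such a set. Put $N^*(n,\varepsilon,\delta,G)=\frac1{m^n}\sum_{|w|=n}N^*(w,\varepsilon,\delta,G)$ and $$h^*(G)=\lim_{\varepsilon\to0}\lim_{\delta\to0}\limsup_{n\to\infty}\frac1n\log N^*(n,\varepsilon,\delta,G).$$ *)

(* Defs.v *)
From HB Require Import structures.
From mathcomp Require Import all_boot all_order all_algebra.
From mathcomp Require Import all_classical all_reals all_analysis.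

Set Implicit Arguments.
Unset Strict Implicit.
Unset Printing Implicit Defensive.

Import Order.TTheory GRing.Theory Num.Theory.
Import numFieldNormedType.Exports.

Local Open Scope classical_set_scope.
Local Open Scope ring_scope.

(* Words of F_m^+ are sequences over 'I_m, words of length n are n-tuples. *)

(* f_(i_0 ... i_(k-1)) = f_(i_0) \o ... \o f_(i_(k-1)): the last letter of the
   word acts first. *)
Definition word_map (X : Type) (m : nat) (f : 'I_m -> X -> X) (w : seq 'I_m)
    : X -> X :=
  foldr (fun i g => f i \o g) id w.

(* The default 0 is harmless: distances are nonnegative and the empty suffix
   always contributes. The suffixes of w have length at most |w|, so they range
   over the finite type of bounded sequences. *)
Definition word_dist (R : realType) (X : metricType R) (m : nat)
    (f : 'I_m -> X -> X) (w : seq 'I_m) (x1 x2 : X) : R :=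
  \big[Num.max/0]_(w' : (size w).-bseq 'I_m | suffix w' (rev w))
     mdist (word_map f w' x1) (word_map f w' x2).

(* The supremum is taken in \bar R, with infinite sets counted as +oo; it is the
   maximum cardinality whenever the cardinalities are bounded, as they are on a
   compact X. *)
Definition max_card (R : realType) (T : choiceType) (P : set (set T))
    : \bar R :=
  ereal_sup [set counting K | K in P].

Section entropy.
Context (R : realType) (X : metricType R) (m : nat) (f : 'I_m -> X -> X).

Definition separated (w : seq 'I_m) (e : R) (K : set X) : Prop :=
  forall x1 x2, K x1 -> K x2 -> x1 <> x2 -> e <= word_dist f w x1 x2.

Definition sep_word (w : seq 'I_m) (e : R) : \bar R :=
  max_card R [set K | separated w e K].

Definition sep_avg (n : nat) (e : R) : \bar R :=
  (((m ^ n)%:R^-1)%:E * \sum_(w : n.-tuple 'I_m) sep_word w e)%E.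

(* lne is the logarithm on \bar R, with lne 0 = -oo (needed for empty X). *)
Definition topological_entropy : \bar R :=
  lim (limn_esup (fun n => (n%:R^-1)%:E * lne (sep_avg n e))%E @[e --> 0^'+]).

Definition chains (n : nat) (w : n.-tuple 'I_m) (delta : R)
    : set (n.+1.-tuple X) :=
  [set x | forall j : 'I_n,
     mdist (f (tnth w j) (tnth x (widen_ord (leqnSn n) j)))
           (tnth x (lift ord0 j)) <= delta].

(* Only the first n of the n + 1 coordinates are compared. *)
Definition pseudo_separated (n : nat) (w : n.-tuple 'I_m) (e delta : R)
    (K : set (n.+1.-tuple X)) : Prop :=
  K `<=` chains w delta /\
  forall x y, K x -> K y -> x <> y ->
    exists i : 'I_n, e < mdist (tnth x (widen_ord (leqnSn n) i))
                               (tnth y (widen_ord (leqnSn n) i)).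

Definition pseudo_sep_word (n : nat) (w : n.-tuple 'I_m) (e delta : R)
    : \bar R :=
  max_card R [set K | pseudo_separated w e delta K].

Definition pseudo_sep_avg (n : nat) (e delta : R) : \bar R :=
  (((m ^ n)%:R^-1)%:E * \sum_(w : n.-tuple 'I_m) pseudo_sep_word w e delta)%E.

Definition pseudo_entropy : \bar R :=
  lim (lim (limn_esup (fun n => (n%:R^-1)%:E * lne (pseudo_sep_avg n e delta))%E
         @[delta --> 0^'+]) @[e --> 0^'+]).

End entropy.

(* Main.v *)
(* A true orbit is a chain for every delta, so h(G) <= h*(G); the extra letter
   in the comparison accounts for the last point of an orbit, which d_w sees
   and pseudo-separation does not.
   Conversely, fix a block length L. For delta small enough, every chain of a
   word of length L stays (eps/4)-close to the orbit of its first point, hence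
   is determined up to eps by the nearest element of a maximal
   (w, eps/4)-separated set. Cutting a word of length qL + r into q blocks of
   length L and a remainder, and summing over all words (the sum of a product
   over independent blocks is the product of the sums), gives
     N*(qL + r, eps, delta) <= N(L, eps/4)^q p^r,
   where p is the number of pieces of diameter at most eps needed to cover X.
   So the growth rate of N* is at most (1/L) log N(L, eps/4) for every L >= 1,
   once delta is small in terms of L; let delta -> 0, then L -> oo. *)
Require Import Defs.
From mathcomp Require Import all_boot all_order all_algebra finmap.
From mathcomp Require Import lra zify.
From mathcomp Require Import all_classical all_reals all_analysis.

Set Implicit Arguments.
Unset Strict Implicit.
Unset Printing Implicit Defensive.

Import Order.TTheory GRing.Theory Num.Theory.

Local Open Scope classical_set_scope.
Local Open Scope ring_scope.

(** * Cardinalities, and sums over concatenated words *)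

Lemma counting_image (R : realType) (T U : choiceType) (g : T -> U)
    (K : set T) :
  {in K &, injective g} -> counting (g @` K) = counting K :> \bar R.
Proof.
move=> /inj_card_eq gK; rewrite /counting.
have [finK|infK] := pselect (finite_set K).
  have fing : finite_set (g @` K) by exact: finite_image.
  rewrite !asboolT//; congr (_%:R%:E).
  by have [n Kn] := finK; rewrite !(@card_fset_set _ _ n)// (card_eq_trans gK).
rewrite !asboolF//; apply: contra_not infK.
by rewrite (eq_finite_set gK).
Qed.

Lemma counting_le_nat (R : realType) (T : choiceType) (phi : T -> nat)
    (K : set T) (c : nat) :
  {in K &, injective phi} -> (forall x, K x -> (phi x < c)%N) ->
  (counting K <= c%:R%:E :> \bar R)%E.
Proof.
move=> inj_phi ltc.
have Kc : (K #<= `I_c)%card.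
  rewrite -(card_le_eql (inj_card_eq inj_phi)); apply: subset_card_le.
  by move=> _ [x Kx <-]; exact: ltc.
rewrite /counting asboolT; last exact: card_le_finite Kc (finite_II c).
by rewrite lee_fin ler_nat geq_card_fset_set.
Qed.

Lemma counting_fset (R : realType) (T : choiceType) (K : {fset T}) :
  counting [set` K] = (#|` K|)%:R%:E :> \bar R.
Proof. by rewrite /counting asboolT// set_fsetK. Qed.

Lemma counting_ge0 (R : realType) (T : choiceType) (K : set T) :
  (0 <= counting K :> \bar R)%E.
Proof. by rewrite /counting; case: ifPn; rewrite ?lee_fin// leey. Qed.

Lemma max_card_ge0 (R : realType) (T : choiceType) (P : set (set T)) :
  P set0 -> (0 <= Defs.max_card R P)%E.
Proof.
move=> P0; apply: le_ereal_sup_tmp; exists (counting (@set0 T)); last first.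
  exact: counting_ge0.
by exists set0.
Qed.

(** Concatenation is injective between finite types of equal cardinality, hence bijective. Taking
    [F] on sequences avoids casts between tuple lengths. *)
Lemma sum_tuple_cat (R : nmodType) (T : finType) (n1 n2 : nat)
    (F : seq T -> R) :
  \sum_(t : (n1 + n2).-tuple T) F t =
  \sum_(t1 : n1.-tuple T) \sum_(t2 : n2.-tuple T) F (t1 ++ t2).
Proof.
rewrite pair_big/=.
pose h (p : n1.-tuple T * n2.-tuple T) := [tuple of p.1 ++ p.2].
rewrite (reindex h)/=; first by [].
apply: onW_bij.
have inj_h : injective h.
  move=> [t1 t2] [u1 u2] /(congr1 val)/= /eqP.
  rewrite eqseq_cat ?size_tuple// => /andP[/eqP e1 /eqP e2].
  by congr (_, _); exact: val_inj.
apply: inj_card_bij inj_h _.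
by rewrite card_prod !card_tuple expnD.
Qed.

(** * Uniform consequences of compactness *)

Section compactness.
Context (R : realType) (X : metricType R).
Hypothesis cptX : compact [set: X].

(** A point is labelled by the index of the first center within [e / 2] in a finite net, so two
    points with equal labels share a center. *)
Lemma compact_coding (e : R) : 0 < e ->
  exists p : nat, exists2 phi : X -> nat, (forall x, (phi x < p)%N) &
    forall x y, phi x = phi y -> mdist x y <= e.
Proof.
move=> e0; have e20 : 0 < e / 2 by rewrite divr_gt0.
pose P (D : {fset X}) x := has [pred c | mdist c x < e / 2] D.
(* Finite sets, directed by inclusion, serve as the parameter of the near-covering form of
   compactness: near [x], every finite set containing [x] works. *)
pose F := filter_from [set: {fset X}]
  (fun D0 => [set D : {fset X} | {subset D0 <= D}]).
have FF : Filter F.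
  apply: filter_fromT_filter; first by exists fset0.
  move=> D1 D2; exists (D1 `|` D2)%fset => D sub.
  by split=> x Dx; apply: sub; rewrite inE Dx ?orbT.
have := cptX; rewrite compact_near_coveringP => /(_ _ F P FF)[x _|D0 _ hasP].
  exists (ball x (e / 2), [set D : {fset X} | x \in D]) => /=.
    split; first exact: nbhsx_ballx.
    by exists [fset x]%fset => // D; apply; rewrite inE.
  move=> [y D]/= []; rewrite ballEmdist/= => xy Dx.
  by apply/hasP; exists x.
have {}hasP x : P D0 x by exact: hasP.
exists (size D0), (fun x => find [pred c | mdist c x < e / 2] D0) => [x|x y xy].
  by rewrite -has_find; exact: hasP.
have /= := nth_find x (hasP x); have /= := nth_find x (hasP y).
rewrite -xy; set c := nth _ _ _ => cy cx.
rewrite (le_trans (metric_triangle _ c _))// (metric_sym x) (splitr e).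
by rewrite lerD// ltW.
Qed.

Lemma compact_equicontinuous_family (I : finType) (f : I -> X -> X) (e : R) :
  (forall i, continuous (f i)) -> 0 < e ->
  \forall d \near 0^'+,
    forall i x y, mdist x y <= d -> mdist (f i x) (f i y) <= e.
Proof.
move=> fc e0; have e20 : 0 < e / 2 by rewrite divr_gt0.
apply: filter_forall => i.
pose P (d : R) x := forall y, mdist x y <= d -> mdist (f i x) (f i y) <= e.
have := cptX; rewrite compact_near_coveringP.
move=> /(_ R 0^'+ P _) nearP.
have : \forall d \near 0^'+, [set: X] `<=` P d.
  apply: nearP => x _.
  have /metricType_numDomainType.cvgrPdist_lt/(_ _ e20) := fc i x.
  move=> /metricType_numDomainType.nbhs_mdistP [r /= r0 fr].
  (* Half of [r] is spent on moving [x] to [x'] and half on [d], so that both [x'] and [y] stay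
     within [r] of [x]. *)
  have r20 : 0 < r / 2 by rewrite divr_gt0.
  exists (ball x (r / 2), [set d | d < r / 2]) => /=.
    by split; [exact: nbhsx_ballx|exact: nbhs_right_lt].
  move=> [x' d]/= []; rewrite ballEmdist/= => xx' dr y x'y.
  rewrite (le_trans (metric_triangle _ (f i x) _))// (splitr e) lerD//.
    rewrite metric_sym ltW// fr//= (lt_trans xx')// ltr_pdivrMr//.
    by rewrite ltr_pMr// ltr1n.
  rewrite ltW// fr//= (le_lt_trans (metric_triangle _ x' _))// (splitr r).
  by rewrite ltrD// (le_lt_trans x'y).
by apply: filterS => d dP x y; exact: dP.
Qed.

End compactness.

(** * Chains, orbits and labellings of chains *)

Section chains.
Context (R : realType) (X : metricType R) (m : nat) (f : 'I_m -> X -> X).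
Context (i0 : 'I_m).
Implicit Types (s t : seq 'I_m) (d e : R).

(** Chains are infinite sequences constrained only up to index [size s]; cutting the word then
    amounts to shifting the sequence. *)
Definition chain s d (x : nat -> X) : Prop :=
  forall j, (j < size s)%N -> mdist (f (nth i0 s j) (x j)) (x j.+1) <= d.

(* The first letter acts first, so that this runs through the maps f_(w') for
   the suffixes w' of the reversed word. *)
Fixpoint word_orbit s (x : X) (k : nat) : X :=
  if k is k'.+1 then f (nth i0 s k') (word_orbit s x k') else x.

Lemma word_orbit_cat s t x k : (k <= size s)%N ->
  word_orbit (s ++ t) x k = word_orbit s x k.
Proof.
by elim: k => //= k IH ks; rewrite nth_cat ks IH// ltnW.
Qed.

Lemma word_map_rev_take s x k : (k <= size s)%N ->
  word_map f (rev (take k s)) x = word_orbit s x k.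
Proof.
elim: k x => [|k IH] x ks; first by rewrite take0.
by rewrite (take_nth i0)// rev_rcons /= IH// ltnW.
Qed.

Lemma suffix_rev_take s t :
  suffix t (rev s) = [exists k : 'I_(size s).+1, t == rev (take k s)].
Proof.
apply/idP/existsP => [|[k /eqP ->]]; last by rewrite suffix_rev prefix_take.
rewrite -[t]revK suffix_rev => /[dup] /size_prefix le_ts.
rewrite prefixE => /eqP tE.
by exists (Ordinal (le_ts : (_ < (size s).+1)%N)); rewrite revK /= tE revK.
Qed.

Lemma word_dist_ge s x y k : (k <= size s)%N ->
  mdist (word_orbit s x k) (word_orbit s y k) <= word_dist f s x y.
Proof.
move=> ks; rewrite -!word_map_rev_take// /word_dist.
have sz : (size (rev (take k s)) <= size s)%N.
  by rewrite size_rev size_take_min geq_minr.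
apply: (le_bigmax_cond _ (fun w : (size s).-bseq 'I_m =>
  mdist (word_map f w x) (word_map f w y)) (j := Bseq sz)).
by rewrite /= suffix_rev prefix_take.
Qed.

Lemma word_dist_geP s x y e : 0 < e -> e <= word_dist f s x y ->
  exists2 k, (k <= size s)%N &
    e <= mdist (word_orbit s x k) (word_orbit s y k).
Proof.
move=> e0; rewrite /word_dist => /bigmax_geP[|[/= t]].
  (* The default [0] of the maximum cannot reach a positive [e]. *)
  by rewrite leNgt e0.
rewrite suffix_rev_take => /existsP[k /eqP tE].
have ks : (k <= size s)%N by rewrite -ltnS.
by rewrite tE !word_map_rev_take// => le_e; exists k.
Qed.

Lemma word_dist_ltP s x y e : 0 < e ->
  word_dist f s x y < e <->
  (forall k, (k <= size s)%N ->
    mdist (word_orbit s x k) (word_orbit s y k) < e).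
Proof.
move=> e0; split => [lt_e k ks|lt_e].
  exact: le_lt_trans (word_dist_ge _ _ ks) lt_e.
rewrite ltNge; apply/negP => /(word_dist_geP e0)[k ks].
by rewrite leNgt lt_e.
Qed.

Lemma word_distC s x y : word_dist f s x y = word_dist f s y x.
Proof. by apply: eq_bigr => t _; exact: metric_sym. Qed.

(* Unlike pseudo-separated sets, whose two halves need not be pseudo-separated,
   such labellings multiply under concatenation of words. *)
Definition coded s d e (c : nat) : Prop :=
  exists phi : (nat -> X) -> nat,
    (forall x, chain s d x -> (phi x < c)%N) /\
    (forall x y, chain s d x -> chain s d y -> phi x = phi y ->
      forall j, (j < size s)%N -> mdist (x j) (y j) <= e).

Lemma coded_cat s1 s2 d e c1 c2 :
  coded s1 d e c1 -> coded s2 d e c2 -> coded (s1 ++ s2) d e (c1 * c2).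
Proof.
move=> [p1 [lt1 eq1]] [p2 [lt2 eq2]].
pose tl (x : nat -> X) j := x (size s1 + j)%N.
have chain1 x : chain (s1 ++ s2) d x -> chain s1 d x.
  move=> ch j js; have := ch j; rewrite nth_cat js; apply.
  by rewrite size_cat ltn_addr.
have chain2 x : chain (s1 ++ s2) d x -> chain s2 d (tl x).
  move=> ch j js; rewrite /tl addnS; have := ch (size s1 + j)%N.
  rewrite nth_cat (_ : (_ < size s1)%N = false).
    by rewrite addKn; apply; rewrite size_cat ltn_add2l.
  by rewrite ltnNge leq_addr.
(* The pair of labels is packed into one number and recovered by division with remainder by [c2],
   which is positive as soon as a chain exists. *)
exists (fun x => p1 x * c2 + p2 (tl x))%N; split=> [x ch|x y chx chy].
  have := lt1 _ (chain1 _ ch); have := lt2 _ (chain2 _ ch); nia.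
have x2 := lt2 _ (chain2 _ chx); have y2 := lt2 _ (chain2 _ chy).
move=> /[dup] /(congr1 (divn^~ c2)) + /(congr1 (modn^~ c2)).
rewrite !divnMDl ?(leq_ltn_trans _ x2)// !divn_small// !addn0.
rewrite !modnMDl !modn_small// => e1 e2 j.
rewrite size_cat; have [js1 _|js1 js] := ltnP j (size s1).
  by apply: (eq1 _ _ (chain1 _ chx) (chain1 _ chy)).
have := eq2 _ _ (chain2 _ chx) (chain2 _ chy) e2 (j - size s1)%N.
by rewrite /tl subnKC//; apply; rewrite ltn_subLR.
Qed.

(** Each point is labelled separately, ignoring the dynamics. This crude count serves for the
    remainder left after cutting a word into blocks. *)
Lemma coded_exp (p : nat) (phi : X -> nat) s d e :
  (forall x, (phi x < p)%N) ->
  (forall x y, phi x = phi y -> mdist x y <= e) ->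
  coded s d e (p ^ size s).
Proof.
move=> ltp phie; elim: s => [|i s IH]; first by exists (fun=> 0%N).
rewrite -cat1s size_cat expnD expn1; apply: coded_cat IH.
by exists (fun x => phi (x 0%N)); split=> // x y _ _ /phie xy [].
Qed.

(** Induction on [k]: the last jump costs at most [e / 2], and equicontinuity keeps the image of the
    earlier error below [e / 2]. The threshold for [d] is the same for all words because the maps
    are treated as one equicontinuous family. *)
Lemma chain_shadowing (k : nat) e : compact [set: X] ->
  (forall i, continuous (f i)) -> 0 < e ->
  \forall d \near 0^'+, forall s x, (k <= size s)%N -> chain s d x ->
    mdist (x k) (word_orbit s (x 0%N) k) <= e.
Proof.
move=> cptX fc; elim: k e => [|k IH] e e0.
  by near=> d => s x _ _ /=; rewrite mdistxx ltW.
have e20 : 0 < e / 2 by rewrite divr_gt0.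
(* [d'] is the accuracy required after [k] steps; it is fixed before [d]. *)
near (0 : R)^'+ => d'.
have d'f : forall i x y, mdist x y <= d' -> mdist (f i x) (f i y) <= e / 2.
  by near: d'; exact: compact_equicontinuous_family.
have d'0 : 0 < d' by near: d'; exact: nbhs_right_gt.
near=> d => s x ks ch /=.
rewrite (le_trans (metric_triangle _ (f (nth i0 s k) (x k)) _))//.
rewrite (splitr e) lerD//.
  rewrite metric_sym (le_trans (ch k ks))//.
  by near: d; exact: nbhs_right_le.
apply: d'f; move: s x {ks} (ltnW ks) ch.
by near: d; exact: IH.
Unshelve. all: by end_near. Qed.

Lemma chain_shadowing_upto (n : nat) e : compact [set: X] ->
  (forall i, continuous (f i)) -> 0 < e ->
  \forall d \near 0^'+, forall s x, size s = n -> chain s d x ->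
    forall k, (k <= n)%N -> mdist (x k) (word_orbit s (x 0%N) k) <= e.
Proof.
move=> cptX fc e0.
have : \forall d \near 0^'+, forall k : 'I_n.+1, forall s x,
    (k <= size s)%N -> chain s d x ->
    mdist (x k) (word_orbit s (x 0%N) k) <= e.
  by apply: filter_forall => k; exact: chain_shadowing.
apply: filterS => d dP s x sn ch k kn.
by apply: (dP (Ordinal (kn : (k < n.+1)%N))) => //=; rewrite sn.
Qed.

(* A maximal separated set is spanning, and a chain is labelled by a nearby
   center of its shadowing orbit. *)
Lemma coded_sep_word s d e : 0 < e -> (sep_word f s (e / 4) < +oo)%E ->
  (forall x, chain s d x -> forall k, (k <= size s)%N ->
     mdist (x k) (word_orbit s (x 0%N) k) <= e / 4) ->
  exists2 c, (c%:R%:E <= sep_word f s (e / 4))%E & coded s d e c.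
Proof.
move=> e0 sepoo shadow; have e40 : 0 < e / 4 by rewrite divr_gt0.
pose P k := `[< exists2 K : {fset X}, #|` K| = k &
  Defs.separated f s (e / 4) [set` K] >].
have Pk k : P k -> (k%:R%:E <= sep_word f s (e / 4))%E.
  move=> /asboolP[K <- Ksep]; apply: ereal_sup_ubound.
  by exists [set` K] => //; rewrite counting_fset.
have P0 : exists k, P k.
  by exists 0%N; apply/asboolP; exists fset0; rewrite ?cardfs0.
(* Finiteness of the supremum bounds the cardinalities, so a separated set of largest cardinality
   exists. *)
have ubP k : P k -> (k <= Num.truncn (fine (sep_word f s (e / 4))))%N.
  move=> /[dup] /Pk + _; case: (sep_word _ _ _) sepoo => [r _| |] //=.
  by rewrite lee_fin => kr; rewrite truncn_ge_nat// (le_trans _ kr).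
case: (ex_maxnP P0 ubP) => c Pc maxc; exists c; first exact: Pk.
have /asboolP[K Kc Ksep] := Pc.
have spanK x : has [pred y | word_dist f s x y < e / 4] K.
  apply/negPn/negP => /hasPn farK.
  have xK : x \notin K.
    apply/negP => /farK /negP; apply; apply/(word_dist_ltP _ _ _ e40) => k _.
    by rewrite mdistxx.
  suff /maxc : P c.+1 by rewrite ltnn.
  apply/asboolP; exists (x |` K)%fset; first by rewrite cardfsU1 xK Kc.
  move=> y z /=; rewrite !inE => /predU1P[->|yK] /predU1P[->|zK] // yz.
  - by have := farK _ zK; rewrite /= -leNgt.
  - by have := farK _ yK; rewrite /= -leNgt word_distC.
  - exact: Ksep.
exists (fun x => find [pred y | word_dist f s (x 0%N) y < e / 4] K).
split=> [x _|x y chx chy xy j js]; first by rewrite -Kc -has_find.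
have /= := nth_find (x 0%N) (spanK (x 0%N)).
have /= := nth_find (x 0%N) (spanK (y 0%N)).
rewrite -xy; set z := nth _ _ _.
move=> /(word_dist_ltP _ _ _ e40)/(_ _ (ltnW js)) yz.
move=> /(word_dist_ltP _ _ _ e40)/(_ _ (ltnW js)) xz.
(* Four distances of at most [e / 4]: from chain to orbit for [x] and for [y], and from each orbit
   to that of the common center [z]. *)
have xx := shadow _ chx _ (ltnW js); have yy := shadow _ chy _ (ltnW js).
have := metric_triangle (x j) (word_orbit s (x 0%N) j) (y j).
have := metric_triangle (word_orbit s (x 0%N) j) (word_orbit s z j) (y j).
have := metric_triangle (word_orbit s z j) (word_orbit s (y 0%N) j) (y j).
rewrite (metric_sym (word_orbit s z j) (word_orbit _ _ _)).
rewrite (metric_sym (word_orbit s (y 0%N) j) (y j)).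
lra.
Qed.

End chains.

(** * Averages over all words of a given length *)

Section averages.
Context (R : realType) (X : metricType R) (m : nat) (f : 'I_m -> X -> X).
Context (i0 : 'I_m).
Implicit Types (n : nat) (d e : R).

Let m_gt0 : (0 < m)%N.
Proof. exact: leq_ltn_trans (ltn_ord i0). Qed.

Let mX_gt0 n : 0 < (m ^ n)%:R :> R.
Proof. by rewrite ltr0n expn_gt0 m_gt0. Qed.

(** Equal labels force [e]-closeness at every compared coordinate, so labels are injective on a
    pseudo-separated set. *)
Lemma pseudo_sep_word_le n (t : n.-tuple 'I_m) d e c :
  coded f i0 t d e c -> (pseudo_sep_word f t e d <= c%:R%:E)%E.
Proof.
move=> [phi [ltc phie]]; apply: ge_ereal_sup => _ [K [Kch Ksep] <-].
(* Beyond index [n] this takes the default of [inord], which [chain] never reads. *)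
pose pt (x : n.+1.-tuple X) j := tnth x (inord j).
have ptE x (j : 'I_n) : pt x j = tnth x (widen_ord (leqnSn n) j).
  by congr (tnth x); apply: val_inj; rewrite /= inordK// ltnS ltnW.
have chK x : K x -> chain f i0 t d (pt x).
  move=> /Kch /= chx j; rewrite size_tuple => jn.
  have := chx (Ordinal jn); rewrite -ptE (tnth_nth i0) /pt /=.
  congr (mdist _ (tnth _ _) <= d).
  by apply: val_inj; rewrite /= inordK.
apply: (@counting_le_nat _ _ (phi \o pt)) => [x y xK yK /= xy|x Kx]; last first.
  exact/ltc/chK.
apply: contrapT => neq_xy.
have Kx := set_mem xK; have Ky := set_mem yK.
have [i] := Ksep _ _ Kx Ky neq_xy; apply/negP; rewrite -leNgt -!ptE.
by apply: (phie _ _ (chK _ Kx) (chK _ Ky) xy); rewrite size_tuple.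
Qed.

(** The number of labels may vary with the word; only its mean is bounded by [C]. This is the
    submultiplicative stand-in for [pseudo_sep_avg]. *)
Definition avg_coded n d e (C : R) : Prop :=
  exists2 g : n.-tuple 'I_m -> nat,
    (forall t : n.-tuple 'I_m, coded f i0 t d e (g t)) &
    \sum_t (g t)%:R <= (m ^ n)%:R * C.

Lemma pseudo_sep_avg_le n d e (C : R) :
  avg_coded n d e C -> (pseudo_sep_avg f n e d <= C%:E)%E.
Proof.
move=> [g gc gC]; rewrite /pseudo_sep_avg.
apply: (@le_trans _ _ (((m ^ n)%:R^-1)%:E * (\sum_t (g t)%:R)%:E)%E).
  apply: lee_wpmul2l; first by rewrite lee_fin invr_ge0 ler0n.
  by rewrite -sumEFin; apply: lee_sum => t _; exact: pseudo_sep_word_le.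
by rewrite -EFinM lee_fin ler_pdivrMl.
Qed.

Lemma avg_coded_cat n1 n2 d e (C1 C2 : R) :
  avg_coded n1 d e C1 -> avg_coded n2 d e C2 ->
  avg_coded (n1 + n2) d e (C1 * C2).
Proof.
move=> [g1 g1c g1C] [g2 g2c g2C].
(* The halves are defined by indexing so that they are tuples for every sequence, as [sum_tuple_cat]
   requires. *)
pose s1 (t : seq 'I_m) := [tuple nth i0 t i | i < n1].
pose s2 (t : seq 'I_m) := [tuple nth i0 t (n1 + i)%N | i < n2].
exists (fun t => (g1 (s1 t) * g2 (s2 t))%N) => [t|].
  suff tE : tval t = s1 t ++ s2 t.
    by rewrite [X in coded _ _ X]tE; exact: coded_cat.
  apply: (@eq_from_nth _ i0); first by rewrite size_cat !size_tuple.
  move=> j; rewrite size_tuple nth_cat size_tuple => jn.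
  case: ltnP => [jn1|n1j].
    by have := tnth_nth i0 (s1 t) (Ordinal jn1); rewrite tnth_mktuple.
  have jn2 : (j - n1 < n2)%N by rewrite ltn_subLR.
  have := tnth_nth i0 (s2 t) (Ordinal jn2).
  by rewrite tnth_mktuple /= subnKC.
rewrite (@sum_tuple_cat _ _ _ _ (fun t => (g1 (s1 t) * g2 (s2 t))%:R)).
have s1E (t1 : n1.-tuple _) (t2 : n2.-tuple _) : s1 (t1 ++ t2) = t1.
  apply: eq_from_tnth => j; rewrite tnth_mktuple nth_cat size_tuple ltn_ord.
  by rewrite (tnth_nth i0).
have s2E (t1 : n1.-tuple _) (t2 : n2.-tuple _) : s2 (t1 ++ t2) = t2.
  apply: eq_from_tnth => j; rewrite tnth_mktuple nth_cat size_tuple.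
  by rewrite ltnNge leq_addr/= addKn (tnth_nth i0).
under eq_bigr do under eq_bigr do rewrite s1E s2E natrM.
under eq_bigr do rewrite -mulr_sumr.
rewrite -mulr_suml expnD natrM mulrACA.
by apply: ler_pM => //; apply: sumr_ge0 => t _; exact: ler0n.
Qed.

Lemma avg_coded_cst n d e (p : nat) :
  (forall s : seq 'I_m, coded f i0 s d e (p ^ size s)) ->
  avg_coded n d e (p%:R ^+ n).
Proof.
move=> pc; exists (fun=> (p ^ n)%N) => [t|]; last first.
  by rewrite sumr_const card_tuple card_ord natrX mulr_natl.
by have := pc t; rewrite size_tuple.
Qed.

Lemma avg_coded_exp n q d e (C : R) :
  avg_coded n d e C -> avg_coded (q * n) d e (C ^+ q).
Proof.
move=> nC; elim: q => [|q IH]; last first.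
  by rewrite mulSn exprS; exact: avg_coded_cat.
rewrite mul0n expr0; exists (fun=> 1%N) => [t|]; last first.
  by rewrite sumr_const card_tuple mulr1.
by exists (fun=> 0%N); split=> // x y _ _ _ j; rewrite tuple0.
Qed.

Lemma sep_word_ge0 (s : seq 'I_m) e : (0 <= sep_word f s e)%E.
Proof. by apply: max_card_ge0 => x y []. Qed.

Lemma sep_avg_ge0 n e : (0 <= sep_avg f n e)%E.
Proof.
apply: mule_ge0; first by rewrite lee_fin invr_ge0 ltW.
by apply: sume_ge0 => t _; exact: sep_word_ge0.
Qed.

Lemma pseudo_sep_avg_ge0 n d e : (0 <= pseudo_sep_avg f n e d)%E.
Proof.
apply: mule_ge0; first by rewrite lee_fin invr_ge0 ltW.
by apply: sume_ge0 => t _; apply: max_card_ge0; split=> // x y [].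
Qed.

(** A singleton is vacuously separated. The bound makes the logarithms nonnegative. *)
Lemma sep_avg_ge1 n e : X -> (1 <= sep_avg f n e)%E.
Proof.
move=> x; have sep1 (s : seq 'I_m) : (1 <= sep_word f s e)%E.
  apply: ereal_sup_ubound; exists [set` [fset x]%fset] => /=; last first.
    by rewrite counting_fset cardfs1.
  by move=> y z /=; rewrite !inE => /eqP -> /eqP ->.
apply: (@le_trans _ _ (((m ^ n)%:R^-1)%:E * (m ^ n)%:R%:E)%E).
  by rewrite -EFinM mulVf// gt_eqF.
apply: lee_wpmul2l; first by rewrite lee_fin invr_ge0 ltW.
apply: (@le_trans _ _ (\sum_(t : n.-tuple 'I_m) 1%:E)%E); last exact: lee_sum.
by rewrite sumEFin sumr_const card_tuple card_ord.
Qed.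

Lemma avg_coded_sep n e : compact [set: X] ->
  (forall i, continuous (f i)) -> 0 < e -> (sep_avg f n (e / 4) < +oo)%E ->
  \forall d \near 0^'+, avg_coded n d e (fine (sep_avg f n (e / 4))).
Proof.
move=> cptX fc e0 avgoo; have e40 : 0 < e / 4 by rewrite divr_gt0.
have sumE : (\sum_(t : n.-tuple 'I_m) sep_word f t (e / 4) =
    (m ^ n)%:R%:E * sep_avg f n (e / 4))%E.
  by rewrite muleA -EFinM mulfV ?mul1e// gt_eqF.
have avgfin : sep_avg f n (e / 4) \is a fin_num.
  by rewrite ge0_fin_numE// sep_avg_ge0.
have sumoo : (\sum_(t : n.-tuple 'I_m) sep_word f t (e / 4) < +oo)%E.
  by rewrite sumE -(fineK avgfin) -EFinM ltry.
(* The terms are nonnegative, so a finite sum makes each of them finite. *)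
have wordoo (t : n.-tuple 'I_m) : (sep_word f t (e / 4) < +oo)%E.
  apply: le_lt_trans sumoo; rewrite (bigD1 t)//= leeDl//.
  by apply: sume_ge0 => u _; exact: sep_word_ge0.
have := chain_shadowing_upto i0 n cptX fc e40; apply: filterS => d shadow.
have /choice[g gP] : forall t : n.-tuple 'I_m, exists c,
    (c%:R%:E <= sep_word f t (e / 4))%E /\ coded f i0 t d e c.
  move=> t; have [|c] := coded_sep_word e0 (wordoo t) (d := d) (i0 := i0).
    move=> x ch k; rewrite size_tuple.
    by apply: shadow => //; rewrite size_tuple.
  by exists c.
exists g => [t|]; first by have [] := gP t.
rewrite -lee_fin EFinM fineK// -sumE -sumEFin.
by apply: lee_sum => t _; have [] := gP t.
Qed.

Lemma sep_word_le_pseudo n (t : n.+1.-tuple 'I_m) d e : 0 <= d -> 0 < e ->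
  (sep_word f (take n t) e <= pseudo_sep_word f t (e / 2) d)%E.
Proof.
move=> d0 e0; apply: ge_ereal_sup => _ [K Ksep <-].
pose orb x := [tuple word_orbit f i0 t x j | j < n.+2].
have orb_inj : injective orb.
  move=> x y /(congr1 (fun u => tnth u ord0)).
  by rewrite !tnth_mktuple.
rewrite -(@counting_image _ _ _ orb); last by move=> x y _ _; exact: orb_inj.
apply: ereal_sup_ubound; exists (orb @` K) => //; split=> [_ [x Kx <-] j|].
  by rewrite !tnth_mktuple (tnth_nth i0)/= mdistxx.
move=> _ _ [x Kx <-] [y Ky <-] xy.
have neq_xy : x <> y by move=> xyE; apply: xy; rewrite xyE.
have [k] := word_dist_geP i0 e0 (Ksep _ _ Kx Ky neq_xy).
have szt : size (take n t) = n by rewrite size_takel// size_tuple.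
rewrite szt => kn le_e; exists (Ordinal (kn : (k < n.+1)%N)).
rewrite !tnth_mktuple/= -(cat_take_drop n t) !word_orbit_cat ?szt//.
(* Halving [e] turns the weak inequality of separation into the strict one of pseudo-separation. *)
by rewrite (lt_le_trans _ le_e)// ltr_pdivrMr// ltr_pMr// ltr1n.
Qed.

Lemma sep_avg_le_pseudo n d e : 0 <= d -> 0 < e ->
  (sep_avg f n e <= pseudo_sep_avg f n.+1 (e / 2) d)%E.
Proof.
move=> d0 e0; rewrite /pseudo_sep_avg.
apply: (@le_trans _ _ (((m ^ n.+1)%:R^-1)%:E *
    \sum_(t : n.+1.-tuple 'I_m) sep_word f (take n t) e)%E); last first.
  apply: lee_wpmul2l; first by rewrite lee_fin invr_ge0 ltW.
  by apply: lee_sum => t _; exact: sep_word_le_pseudo.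
(* The summand ignores the last letter; summing it out gives a factor [m] that cancels in
   [m ^ n.+1]. *)
rewrite -[in X in (_ <= X)%E]addn1.
rewrite (@sum_tuple_cat _ _ n 1 (fun t => sep_word f (take n t) e)).
under eq_bigr => t1 _ do under eq_bigr => t2 _ do
  rewrite take_size_cat ?size_tuple//.
under eq_bigr => t1 _ do rewrite sumr_const card_tuple card_ord expn1.
have natmulE (x : \bar R) k : (x *+ k)%R = (k%:R%:E * x)%E.
  by rewrite mule_natl.
rewrite sumrMnl natmulE muleA -EFinM expnD expn1 natrM invfM -mulrA.
by rewrite mulVf ?mulr1// pnatr_eq0 -lt0n m_gt0.
Qed.

End averages.

(** * Upper limits and one-sided limits in the extended reals *)

Section limits.
Local Open Scope ereal_scope.
Context (R : realType).
Implicit Types (u : (\bar R)^nat) (x y : \bar R).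

(** Reduces upper bounds to real thresholds, so that infinite upper limits need no separate case. *)
Lemma lee_of_fin_gt x y : (forall c : R, x < c%:E -> y <= c%:E) -> y <= x.
Proof.
move: x => [r| |] yc; last 2 first.
- exact: leey.
- by rewrite leeNy_eq; apply/eqP/eq_ninfty => c; apply: yc; exact: ltNyr.
apply/lee_addgt0Pr => e e0; rewrite -EFinD.
by apply: yc; rewrite lte_fin ltrDl.
Qed.

Lemma limn_esup_lt u x : limn_esup u < x -> \forall n \near \oo, u n < x.
Proof.
rewrite /limn_esup limf_esupE => /ereal_inf_lt[_ [V Voo <-]] ltx.
apply: filterS Voo => n Vn; apply: le_lt_trans ltx.
by apply: ereal_sup_ubound; exists n.
Qed.

Lemma limn_esup_le u x : (\forall n \near \oo, u n <= x) -> limn_esup u <= x.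
Proof.
move=> ux; rewrite /limn_esup limf_esupE.
apply: (@le_trans _ _ (ereal_sup (u @` [set n | u n <= x]))).
  by apply: ereal_inf_lbound; exists [set n | u n <= x].
by apply: ge_ereal_sup => _ [n /= un <-].
Qed.

Lemma limn_esup_ge u x : (\forall n \near \oo, x <= u n) -> x <= limn_esup u.
Proof.
move=> xu; rewrite leNgt; apply/negP => /limn_esup_lt ux.
have [n []] := filter_ex (filterI xu ux).
by rewrite leNgt => /negP.
Qed.

(* The error term b / n absorbs what is lost at the ends of the words. *)
Lemma limn_esup_le_slack u (c b : R) :
  (\forall n \near \oo, u n <= (c + b / n%:R)%:E) -> limn_esup u <= c%:E.
Proof.
move=> ub; apply/lee_addgt0Pr => e e0; apply: limn_esup_le; near=> n.
have n0 : (0 < n%:R :> R)%R by rewrite ltr0n; near: n; exact: nbhs_infty_gt.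
apply: (le_trans (near ub n _)) => //; rewrite -EFinD lee_fin lerD2l.
rewrite ler_pdivrMr// -ler_pdivrMl// (le_trans (ler_norm _))//.
by near: n; exact: nbhs_infty_ger.
Unshelve. all: by end_near. Qed.

(** Monotonicity ensures convergence in [\bar R], so [lim] is a genuine limit and not a default
    value. *)
Lemma lim_at_right0_nonincreasing (F : R -> \bar R) :
  {in `]0%R, +oo[ &, {homo F : d e / (d <= e)%R >-> e <= d}} ->
  lim (F e @[e --> 0^'+]) = ereal_sup (F @` [set e | (0 < e)%R]).
Proof.
move=> F_ni; have /cvg_lim := nonincreasing_at_right_cvge +oo%O isT F_ni.
move=> -> //; congr (ereal_sup (F @` _)).
by apply/seteqP; split=> e /=; rewrite in_itv/= andbT.
Qed.

Lemma lim_at_right0_nondecreasing (F : R -> \bar R) :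
  {in `]0%R, +oo[ &, {homo F : d e / (d <= e)%R >-> d <= e}} ->
  lim (F e @[e --> 0^'+]) = ereal_inf (F @` [set e | (0 < e)%R]).
Proof.
move=> F_nd; have /cvg_lim := nondecreasing_at_right_cvge +oo%O isT F_nd.
move=> -> //; congr (ereal_inf (F @` _)).
by apply/seteqP; split=> e /=; rewrite in_itv/= andbT.
Qed.

Lemma le_limn_esup u v : (forall n, u n <= v n) -> limn_esup u <= limn_esup v.
Proof.
move=> uv; apply: lee_of_fin_gt => c /limn_esup_lt vc.
by apply: limn_esup_le; apply: filterS vc => n /ltW; exact: le_trans.
Qed.

Lemma lee_lne_homo : {in [set x | 0 <= x] &, {homo @lne R : x y / x <= y}}.
Proof.
move=> x y; rewrite !inE/= => x0 y0 xy.
by rewrite lee_lne// in_itv/= ?x0 ?y0 leey.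
Qed.

End limits.

(** * Comparison of the growth rates over a nonempty space *)

Section growth_rates.
Context (R : realType) (X : metricType R) (m : nat) (f : 'I_m -> X -> X).
Context (i0 : 'I_m) (x0 : X).
Hypothesis cptX : compact [set: X].
Hypothesis f_cont : forall i, continuous (f i).
Implicit Types (n : nat) (d e : R).

Definition top_rate e : \bar R :=
  limn_esup (fun n => (n%:R^-1)%:E * lne (sep_avg f n e))%E.

Definition pseudo_rate e d : \bar R :=
  limn_esup (fun n => (n%:R^-1)%:E * lne (pseudo_sep_avg f n e d))%E.

Let inv_nat_ge0 n : (0 <= (n%:R^-1)%:E :> \bar R)%E.
Proof. by rewrite lee_fin invr_ge0. Qed.

Lemma le_limn_esup_lne (a b : (\bar R)^nat) :
  (forall n, 0 <= a n)%E -> (forall n, a n <= b n)%E ->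
  (limn_esup (fun n => (n%:R^-1)%:E * lne (a n)) <=
   limn_esup (fun n => (n%:R^-1)%:E * lne (b n)))%E.
Proof.
move=> a0 ab; apply: le_limn_esup => n; apply: lee_wpmul2l => //.
by apply: lee_lne_homo; rewrite ?inE//= (le_trans (a0 n)).
Qed.

Lemma top_rate_nonincreasing :
  {homo top_rate : e1 e2 / e1 <= e2 >-> (e2 <= e1)%E}.
Proof.
move=> e1 e2 e12; apply: le_limn_esup_lne => n; first exact: sep_avg_ge0.
apply: lee_wpmul2l; first by rewrite lee_fin invr_ge0.
apply: lee_sum => t _; apply: ereal_sup_le => _ [K Ksep <-]; exists K => //.
by move=> x y Kx Ky xy; rewrite (le_trans e12)//; exact: Ksep.
Qed.

Lemma pseudo_rate_le e1 e2 d1 d2 : e1 <= e2 -> d1 <= d2 ->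
  (pseudo_rate e2 d1 <= pseudo_rate e1 d2)%E.
Proof.
move=> e12 d12; apply: le_limn_esup_lne => n; first exact: pseudo_sep_avg_ge0.
apply: lee_wpmul2l; first by rewrite lee_fin invr_ge0.
apply: lee_sum => t _; apply: ereal_sup_le => _ [K [Kch Ksep] <-].
exists K => //.
split=> [x /Kch ch j|x y Kx Ky /(Ksep _ _ Kx Ky)[i xy]].
  exact: le_trans (ch j) d12.
by exists i; exact: le_lt_trans xy.
Qed.

Lemma top_le_pseudo_rate e d : 0 <= d -> 0 < e ->
  (top_rate e <= pseudo_rate (e / 2) d)%E.
Proof.
move=> d0 e0; apply: lee_of_fin_gt => c /limn_esup_lt [N _ Nc].
(* The bound [c * (n + 1)] on the logarithm at [n.+1], divided by [n], leaves the slack [c / n]. *)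
apply: (@limn_esup_le_slack _ _ _ c); exists (maxn N 1) => // n /=.
rewrite geq_max => /andP[Nn n1].
have n0 : 0 < n%:R :> R by rewrite ltr0n.
have := Nc n.+1 (leqW Nn) => /=.
have := sep_avg_le_pseudo f i0 n d0 e0.
have := sep_avg_ge1 f i0 n e x0.
move: (pseudo_sep_avg _ _ _ _) => b a1 ab; have b1 := le_trans a1 ab.
case: b b1 ab => [r r1 ab| _ _ |] //; last first.
  by rewrite /= gt0_muley ?lte_fin ?invr_gt0// ltNge leey.
have r0 : 0 < r by rewrite -lte_fin (lt_le_trans _ r1).
rewrite lne_EFin// -EFinM lte_fin mulrC ltr_pdivrMr ?ltr0n// => rc.
apply: (@le_trans _ _ ((n%:R^-1)%:E * lne r%:E)%E).
  apply: lee_wpmul2l => //; apply: lee_lne_homo => //; rewrite inE/=.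
    exact: le_trans a1.
  by rewrite lee_fin ltW.
rewrite lne_EFin// -EFinM lee_fin mulrC ler_pdivrMr// mulrDl divfK ?gt_eqF//.
by rewrite (le_trans (ltW rc))// -natr1 mulrDr mulr1.
Qed.

Lemma pseudo_le_top_term (L : nat) e : (0 < L)%N -> 0 < e ->
  \forall d \near 0^'+,
    (pseudo_rate e d <= (L%:R^-1)%:E * lne (sep_avg f L (e / 4)))%E.
Proof.
move=> L0 e0; have [avgoo|] := eqVneq (sep_avg f L (e / 4)) +oo%E.
  near=> d; rewrite avgoo gt0_muley ?leey// lte_fin invr_gt0 ltr0n//.
rewrite -ltey => avgoo; near=> d.
have : avg_coded f i0 L d e (fine (sep_avg f L (e / 4))).
  by near: d; exact: avg_coded_sep.
have avgfin : sep_avg f L (e / 4) \is a fin_num.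
  by rewrite ge0_fin_numE// (sep_avg_ge0 f i0).
have := sep_avg_ge1 f i0 L (e / 4) x0.
rewrite -(fineK avgfin) /=; move: (fine _) => C; rewrite lee_fin => C1 LC.
have C0 : 0 < C by exact: lt_le_trans C1.
have [p [phi ltp phie]] := compact_coding cptX e0.
have p0 : (0 < p)%N := leq_ltn_trans (leq0n _) (ltp x0).
have p0R : 0 < p%:R :> R by rewrite ltr0n.
have lnp0 : 0 <= ln p%:R :> R by rewrite ln_ge0// ler1n.
have lnC0 : 0 <= ln C by rewrite ln_ge0.
rewrite -/(lne C%:E) lne_EFin// -EFinM.
(* The remainder has fewer than [L] letters, each contributing [ln p] to the logarithm. *)
apply: (@limn_esup_le_slack _ _ _ (L%:R * ln p%:R)); exists 1%N => // n /= n1.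
have n0 : 0 < n%:R :> R by rewrite ltr0n.
have := avg_coded_cat (avg_coded_exp (n %/ L) LC)
  (avg_coded_cst (n %% L) (fun s => coded_exp f i0 s d ltp phie)).
rewrite -divn_eq => /pseudo_sep_avg_le bC.
have Cp0 : 0 < C ^+ (n %/ L) * p%:R ^+ (n %% L).
  by rewrite mulr_gt0// exprn_gt0.
apply: (@le_trans _ _ ((n%:R^-1)%:E *
    lne (C ^+ (n %/ L) * p%:R ^+ (n %% L))%:E)%E).
  apply: lee_wpmul2l => //; apply: lee_lne_homo => //; rewrite inE/=.
    exact: (pseudo_sep_avg_ge0 f i0).
  by rewrite lee_fin ltW.
rewrite lne_EFin// -EFinM lee_fin lnM ?posrE ?exprn_gt0// !lnXn//.
rewrite mulrDr lerD//.
  (* The number of blocks is at most [n / L], and [ln C] is nonnegative. *)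
  rewrite -[ln C *+ _]mulr_natl mulrA ler_wpM2r// mulrC.
  rewrite ler_pdivrMr// ler_pdivlMl ?ltr0n//.
  by rewrite -natrM ler_nat mulnC leq_divM.
rewrite mulrC ler_wpM2r ?invr_ge0// -[ln _ *+ _]mulr_natl.
rewrite ler_wpM2r// ler_nat ltnW//.
exact: ltn_pmod.
Unshelve. all: by end_near. Qed.

(** This is the inner limit as [delta] tends to [0], an infimum because the rate is monotone in
    [d]. *)
Definition pseudo_rate0 e : \bar R :=
  ereal_inf (pseudo_rate e @` [set d | 0 < d]).

Lemma top_le_pseudo_rate0 e : 0 < e -> (top_rate e <= pseudo_rate0 (e / 2))%E.
Proof.
move=> e0; apply: le_ereal_inf_tmp => _ [d /= d0 <-].
by apply: top_le_pseudo_rate => //; exact: ltW.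
Qed.

(** The choice of [d] may depend on [L], since the infimum over [d] lies below the term of every
    block length. *)
Lemma pseudo_rate0_le_top e : 0 < e -> (pseudo_rate0 e <= top_rate (e / 4))%E.
Proof.
move=> e0; apply: limn_esup_ge; exists 1%N => // L /= L0.
near (0 : R)^'+ => d.
have d0 : 0 < d by near: d; exact: nbhs_right_gt.
apply: (@le_trans _ _ (pseudo_rate e d)).
  by apply: ereal_inf_lbound; exists d.
by near: d; exact: pseudo_le_top_term.
Unshelve. all: by end_near. Qed.

Lemma topological_entropyE :
  topological_entropy f = ereal_sup (top_rate @` [set e | 0 < e]).
Proof.
apply: lim_at_right0_nonincreasing => e1 e2 _ _.
exact: top_rate_nonincreasing.
Qed.

Lemma pseudo_entropyE :
  pseudo_entropy f = ereal_sup (pseudo_rate0 @` [set e | 0 < e]).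
Proof.
rewrite -lim_at_right0_nonincreasing => [|e1 e2 _ _ e12]; last first.
  apply: le_ereal_inf_tmp => _ [d /= d0 <-].
  apply: (@le_trans _ _ (pseudo_rate e2 d)); last exact: pseudo_rate_le.
  by apply: ereal_inf_lbound; exists d.
suff -> : pseudo_rate0 = fun e => lim (pseudo_rate e d @[d --> 0^'+]) by [].
apply/funext => e; rewrite lim_at_right0_nondecreasing// => d1 d2 _ _.
exact: pseudo_rate_le.
Qed.

Lemma entropies_eq : topological_entropy f = pseudo_entropy f.
Proof.
rewrite topological_entropyE pseudo_entropyE; apply/eqP; rewrite eq_le.
apply/andP; split; apply: ge_ereal_sup => _ [e /= e0 <-].
  (* The changes of scale are absorbed by the suprema over all positive [e]. *)
  apply: le_trans (top_le_pseudo_rate0 e0) _; apply: ereal_sup_ubound.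
  by exists (e / 2) => //=; rewrite divr_gt0.
apply: le_trans (pseudo_rate0_le_top e0) _; apply: ereal_sup_ubound.
by exists (e / 4) => //=; rewrite divr_gt0.
Qed.

End growth_rates.

(** * The empty space and the conclusion *)

Lemma max_card_empty (R : realType) (T : choiceType) (P : set (set T)) :
  (T -> False) -> P set0 -> Defs.max_card R P = 0%E.
Proof.
move=> T0 P0; apply/eqP; rewrite eq_le max_card_ge0// andbT.
apply: ge_ereal_sup => _ [K _ <-].
have -> : K = [set` fset0].
  by apply/seteqP; split=> x; [case: (T0 x)|rewrite /= inE].
by rewrite counting_fset cardfs0.
Qed.

Theorem theorem1p1 (R : realType) (X : metricType R) (m : nat)
    (f : 'I_m -> X -> X) :
  (1 <= m)%N -> compact [set: X] -> (forall i : 'I_m, continuous (f i)) ->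
  topological_entropy f = pseudo_entropy f.
Proof.
move=> m_gt0 cptX f_cont.
have [[x0 _]|X0] := pselect ([set: X] !=set0).
  exact: (entropies_eq (Ordinal m_gt0) x0).
have {}X0 (x : X) : False by apply: X0; exists x.
(* Over an empty space all cardinalities are [0]; a chain has at least one point even for the empty
   word, so there are no chains. The limit in [delta] is then that of a constant. *)
have avgE n e d : pseudo_sep_avg f n e d = sep_avg f n e.
  congr (_ * _)%E; apply: eq_bigr => t _; rewrite /pseudo_sep_word /sep_word.
  rewrite max_card_empty; first by rewrite max_card_empty// => x y [].
    by move=> t'; exact: X0 (thead t').
  by split=> // x y [].
rewrite /pseudo_entropy; under eq_fun do under eq_fun do under eq_fun do
  rewrite avgE.
under eq_fun do rewrite lim_cst//.
by [].
Qed.
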